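(* Let $\ell$ be a positive integer. If $n_1$, $n_2$, and $n_3$ are positive integers such that $n_1\ge n_2\ge n_3\ge 32\ell^3+40\ell^2+11\ell$, then $$\operatorname{sat}(K_{n_1,n_2,n_3},K_{\ell,\ell,\ell})=2\ell(n_1+n_2+n_3)-3\ell^2-3.$$ Furthermore, the graphs $G_1$, $G_2^1$, $G_2^2$, $G_2^3$ defined in the context are, up to isomorphism, the only $K_{\ell,\ell,\ell}$-saturated subgraphs of $K_{n_1,n_2,n_3}$ with this number of edges.
   Context: All graphs are simple, and $[k]=\{1,\dots,k\}$. For graphs $F$ and $H$, a subgraph $G$ of $H$ (with $V(G)=V(H)$) is an $F$-saturated subgraph of $H$ if $G$ contains no copy of $F$ as a (not necessarily induced) subgraph, but $G+e$ contains a copy of $F$ for every $e\in E(H)\setminus E(G)$. The number $\operatorname{sat}(H,F)$ is the minimum number of edges in an $F$-saturated subgraph of $H$. The host graph $K_{n_1,n_2,n_3}$ is the complete tripartite graph with partite sets $V_1,V_2,V_3$, where $V_i=\{v_i^1,\dots,v_i^{n_i}\}$. The graph $K_{\ell,\ell,\ell}$ is the complete tripartite graph with all part sizes $\ell$. Arithmetic in subscripts is modulo 3 (with values in $[3]$). Graph $G_1$: For $i\in[3]$ let $S_i=\{v_i^{n_i-\ell+1},\dots,v_i^{n_i}\}$ (the last $\ell$ vertices of $V_i$), and join every vertex of $S_i$ to all vertices of $V_{i+1}\cup V_{i+2}$; there are no other edges. Then delete the three edges $v_1^{n_1}v_2^{n_2}$, $v_1^{n_1}v_3^{n_3}$, $v_2^{n_2}v_3^{n_3}$.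 Graph $G_2^i$ (for $i\in[3]$): constructed exactly as $G_1$, except that in the final step one deletes the three edges $v_i^{n_i}v_{i+1}^{n_{i+1}}$, $v_i^{n_i-1}v_{i+2}^{n_{i+2}}$, $v_{i+1}^{n_{i+1}}v_{i+2}^{n_{i+2}}$ instead of $v_1^{n_1}v_2^{n_2}$, $v_1^{n_1}v_3^{n_3}$, $v_2^{n_2}v_3^{n_3}$.
   Formalization: That the graphs G_2^i are saturated with this number of edges is claimed only for ℓ ≥ 2; for ℓ = 1 they contain a triangle K_{1,1,1}, so the claim is false there. Everything else is for all ℓ ≥ 1. *)

(* Defs.v *)
From mathcomp Require Import all_boot.

Set Implicit Arguments.
Unset Strict Implicit.
Unset Printing Implicit Defensive.

Record sgraph (T : finType) := SGraph {
  adj :> rel T;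
  adj_sym : symmetric adj;
  adj_irr : irreflexive adj }.

Section Saturation.
Variables T U : finType.

Definition edges (G : sgraph T) : {set {set T}} :=
  [set [set p.1; p.2] | p : T * T & G p.1 p.2].

Definition subgraph (G H : sgraph T) : Prop := forall x y, G x y -> H x y.

(* Not necessarily induced copies. *)
Definition contains (G : sgraph T) (F : sgraph U) : Prop :=
  exists f : U -> T, injective f /\ forall u v, F u v -> G (f u) (f v).

(* The conjunct u != v makes this a simple graph even for a = b, in which case
   nothing is added. *)
Definition add_edge_rel (G : sgraph T) (a b : T) : rel T :=
  fun u v => G u v || (u != v) && ([set u; v] == [set a; b]).

Lemma add_edge_sym G a b : symmetric (add_edge_rel G a b).
Proof. by move=> u v; rewrite /add_edge_rel adj_sym eq_sym setUC. Qed.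

Lemma add_edge_irr G a b : irreflexive (add_edge_rel G a b).
Proof. by move=> u; rewrite /add_edge_rel adj_irr eqxx. Qed.

Definition add_edge (G : sgraph T) (a b : T) : sgraph T :=
  SGraph (@add_edge_sym G a b) (@add_edge_irr G a b).

Definition saturated_subgraph (H : sgraph T) (F : sgraph U) (G : sgraph T) :
    Prop :=
  [/\ subgraph G H,
      ~ contains G F &
      forall x y, H x y -> ~~ G x y -> contains (add_edge G x y) F].

(* sat(H, F) = m *)
Definition is_sat (H : sgraph T) (F : sgraph U) (m : nat) : Prop :=
  (exists2 G, saturated_subgraph H F G & #|edges G| = m) /\
  (forall G, saturated_subgraph H F G -> m <= #|edges G|).

Definition isomorphic (G : sgraph T) (G' : sgraph U) : Prop :=
  exists f : T -> U, bijective f /\ forall x y, G' (f x) (f y) = G x y.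

End Saturation.

Definition sizes (n1 n2 n3 : nat) (i : 'I_3) : nat := nth 0 [:: n1; n2; n3] i.

Section Tripartite.
Variable n : 'I_3 -> nat.

(* The partite sets are indexed by 'I_3 instead of {1, 2, 3}. *)
Definition vertex : finType := {i : 'I_3 & 'I_(n i)}.

Definition complete_tripartite_rel : rel vertex := fun x y => tag x != tag y.

Lemma complete_tripartite_sym : symmetric complete_tripartite_rel.
Proof. by move=> x y; rewrite /complete_tripartite_rel eq_sym. Qed.

Lemma complete_tripartite_irr : irreflexive complete_tripartite_rel.
Proof. by move=> x; rewrite /complete_tripartite_rel eqxx. Qed.

Definition complete_tripartite : sgraph vertex :=
  SGraph complete_tripartite_sym complete_tripartite_irr.

(* The vertex v_i^j, with the superscript j ranging over 1, ..., n i, is the one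
   with label (i, j). *)
Definition label (x : vertex) : 'I_3 * nat := (tag x, (tagged x).+1).

Variable l : nat.

Definition in_S (x : vertex) : bool := n (tag x) - l + 1 <= (label x).2.

(* All edges with an end in some S_i, except those joining v_i^j and v_i'^j' for
   ((i, j), (i', j')) in D. *)
Definition hub_rel (D : seq (('I_3 * nat) * ('I_3 * nat))) : rel vertex :=
  fun x y => [&& tag x != tag y, in_S x || in_S y,
                 (label x, label y) \notin D & (label y, label x) \notin D].

Lemma hub_sym D : symmetric (hub_rel D).
Proof.
move=> x y; rewrite /hub_rel eq_sym orbC.
by congr [&& _, _ & _]; rewrite andbC.
Qed.

Lemma hub_irr D : irreflexive (hub_rel D).
Proof. by move=> x; rewrite /hub_rel eqxx. Qed.

Definition hub_graph D : sgraph vertex := SGraph (@hub_sym D) (@hub_irr D).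

Definition G1 : sgraph vertex :=
  let p1 : 'I_3 := ord0 in let p2 := ordS p1 in let p3 := ordS p2 in
  hub_graph [:: ((p1, n p1), (p2, n p2));
                ((p1, n p1), (p3, n p3));
                ((p2, n p2), (p3, n p3))].

(* For l = 1 the vertex v_i^(n_i - 1) lies outside S_i, so that the edge
   v_i^(n_i) v_(i+2)^(n_(i+2)) survives and, if n (i+1) > 1, lies in a triangle:
   G2 i is K_(l,l,l)-saturated only when l > 1. *)
Definition G2 (i : 'I_3) : sgraph vertex :=
  let j := ordS i in let k := ordS j in
  hub_graph [:: ((i, n i), (j, n j));
                ((i, n i - 1), (k, n k));
                ((j, n j), (k, n k))].

End Tripartite.

(* Main.v *)
Require Import Defs.
From mathcomp Require Import all_boot.
From mathcomp Require Import zify.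

(** Let [v] be the number of vertices.  Joining two nonadjacent vertices [x] and
    [y] of different parts creates a copy whose third side consists of [l]
    common neighbours of [x] and [y], and whose other two sides are, apart from
    [x] and [y], made of neighbours of [y] and of [x].  Hence every vertex of
    [V j] outside the neighbourhood [N j x] of a vertex [x] of [V i] has at least
    [l] neighbours in the set [N k x], and conversely; so [V j] and [V k] span at
    least [l (n j + n k - deg x)] edges ([edges_opposite]).  If each part contains
    a vertex of bounded degree, this already gives [2 l v - O(1)] edges.

    To find such vertices in a graph with fewer than [2 l v] edges, note that the
    largest part has average degree below [6 l].  The two smaller parts need more
    care, because a part may be much smaller than the others and then has a large
    average degree; the edges to the larger parts are however concentrated in few
    vertices ([few_nbrs_in_largest], [low_degree_third]).
    All degrees are at least [2 l], and a part without vertices of degree exactly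
    [2 l] would cost too many edges ([exact_degree]).

    So each part contains a vertex of degree exactly [2 l], with [l] neighbours in
    each other part.  These two neighbourhoods span a complete bipartite graph
    with at most one missing edge, and every vertex outside one of them is
    adjacent to all of the other ([exact_degree_pairs]).  Therefore [V j] and
    [V k] span at least [l (n j + n k) - l ^ 2 - 1] edges, and adding the three
    bounds gives [2 l v - 3 l ^ 2 - 3].  In case of equality the graph consists of
    all edges that meet a set of [l] hubs in each part, except for one missing
    edge between the hubs of each two parts ([exact_degree_hub]).

    For such a hub configuration, consider the copy created by joining two
    vertices that are not hubs: it omits one hub of each of their parts, and these
    two hubs have to cover the three missing edges.  This forces each missing edge
    to share an endpoint with another one ([saturated_linked]), and conversely
    this condition makes the configuration saturated ([hub_config_saturated]).
    Three edges between the hubs of three parts that are linked in this way either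
    share endpoints in all three parts, which is [G1], or in all but one part [i],
    which is [G2 i] ([hub_config_classification]). *)

Set Implicit Arguments.
Unset Strict Implicit.
Unset Printing Implicit Defensive.

(** * Counting edges between sets of vertices *)

Lemma sum_nat_of_mem (T : finType) (X : {set T}) (P : pred T) :
  \sum_(x in X) (P x : nat) = #|[set x in X | P x]|.
Proof.
rewrite -sum1_card big_mkcond [RHS]big_mkcond /=.
by apply: eq_bigr => x _; rewrite inE; case: (x \in X); case: (P x).
Qed.

Section EdgeCount.
Variables (T : finType) (G : sgraph T).
Implicit Types (X Y : {set T}) (x y : T).

Definition edges_between X Y : nat := \sum_(x in X) \sum_(y in Y) G x y.

Lemma edges_betweenC X Y : edges_between X Y = edges_between Y X.
Proof.
rewrite /edges_between exchange_big; apply: eq_bigr => x _.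
by apply: eq_bigr => y _; rewrite adj_sym.
Qed.

Lemma sum_adjE x Y : \sum_(y in Y) G x y = #|[set y in Y | G x y]|.
Proof. exact: sum_nat_of_mem. Qed.

Lemma edges_between_degree X Y d :
  (forall x, x \in X -> d <= \sum_(y in Y) G x y) ->
  d * #|X| <= edges_between X Y.
Proof.
by move=> h; rewrite mulnC -sum_nat_const; apply: leq_sum.
Qed.

Lemma edges_between_sub X X' Y Y' :
  X \subset X' -> Y \subset Y' -> edges_between X Y <= edges_between X' Y'.
Proof.
move=> /subsetP sX /subsetP sY; rewrite /edges_between.
rewrite big_mkcond [leqRHS]big_mkcond; apply: leq_sum => x _.
case: ifP => // /sX ->.
rewrite big_mkcond [leqRHS]big_mkcond; apply: leq_sum => y _.
by case: ifP => // /sY ->.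
Qed.

Lemma edges_between_disjoint X1 X2 Y1 Y2 X Y :
  [disjoint X1 & X2] -> X1 \subset X -> X2 \subset X ->
  Y1 \subset Y -> Y2 \subset Y ->
  edges_between X1 Y1 + edges_between X2 Y2 <= edges_between X Y.
Proof.
move=> dX sX1 sX2 sY1 sY2.
have sU : X1 :|: X2 \subset X by rewrite subUset sX1.
apply: leq_trans (edges_between_sub sU (subxx Y)).
have -> : edges_between (X1 :|: X2) Y = edges_between X1 Y + edges_between X2 Y.
  rewrite /edges_between -bigU //=; apply: eq_bigl => x; exact: in_setU.
by apply: leq_add; apply: edges_between_sub.
Qed.

End EdgeCount.

Lemma leq_sum_all_eq (I : finType) (f g : I -> nat) :
  (forall i, f i <= g i) -> \sum_i g i <= \sum_i f i -> forall i, f i = g i.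
Proof.
move=> le_fg le_sum i; apply/eqP; rewrite eqn_leq le_fg /=.
move: le_sum; rewrite (bigD1 i) //= [leqRHS](bigD1 i) //=.
have : \sum_(j | j != i) f j <= \sum_(j | j != i) g j by apply: leq_sum.
lia.
Qed.

(** * The cyclic order of the three parts *)

Lemma ordS_neq (i : 'I_3) : ordS i != i.
Proof. by case: i => [[|[|[|i]]] hi]. Qed.

Lemma ordS_ordS_neq (i : 'I_3) : ordS (ordS i) != i.
Proof. by case: i => [[|[|[|i]]] hi]. Qed.

Lemma ordS3 (i : 'I_3) : ordS (ordS (ordS i)) = i.
Proof. by apply: val_inj; case: i => [[|[|[|i]]] hi]. Qed.

Lemma ord3_cases (i t : 'I_3) : [\/ t = i, t = ordS i | t = ordS (ordS i)].
Proof.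
case: (t =P i) => [->|/eqP h1]; first by constructor 1.
case: (t =P ordS i) => [->|/eqP h2]; first by constructor 2.
constructor 3; apply: val_inj; move: h1 h2.
by case: i t => [[|[|[|i]]] hi] [[|[|[|t]]] ht].
Qed.

Lemma ord3_distinct (i j k : 'I_3) : i != j -> i != k -> j != k ->
  (j = ordS i /\ k = ordS (ordS i)) \/ (j = ordS (ordS i) /\ k = ordS i).
Proof.
case: (ord3_cases i j) => ->; case: (ord3_cases i k) => ->; rewrite ?eqxx //; auto.
Qed.

Lemma ord3_third (i j : 'I_3) : i != j -> exists2 k, i != k & j != k.
Proof.
case: (ord3_cases i j) => ->; rewrite ?eqxx // => _.
  by exists (ordS (ordS i)); rewrite eq_sym ?ordS_ordS_neq ?ordS_neq.
by exists (ordS i); rewrite ?ordS_neq // eq_sym ordS_neq.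
Qed.

Lemma ord3_sum (f : 'I_3 -> nat) i j k : i != j -> i != k -> j != k ->
  \sum_t f t = f i + f j + f k.
Proof.
move=> ij ik jk; rewrite (bigD1 i) //= (bigD1 j) /=; last by rewrite eq_sym.
rewrite (bigD1 k) /=; last by rewrite ![k == _]eq_sym ik.
rewrite big1 ?addn0 ?addnA // => t /andP[/andP[ti tj] tk].
case: (ord3_distinct ij ik jk) => -[ej ek]; subst j k.
  by case: (ord3_cases i t) ti tj tk => ->; rewrite eqxx.
by case: (ord3_cases i t) ti tj tk => ->; rewrite eqxx.
Qed.

Lemma ord3_sum_cyclic (f : 'I_3 -> nat) :
  \sum_i f i = f ord0 + f (ordS ord0) + f (ordS (ordS ord0)).
Proof. exact: ord3_sum. Qed.

(** * Subgraphs of a complete tripartite graph *)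

Section Tripartite.
Variables (n : 'I_3 -> nat).
Notation T := (vertex n).
Notation H := (complete_tripartite n).

Definition part (i : 'I_3) : {set T} := [set x | tag x == i].

Lemma card_part i : #|part i| = n i.
Proof.
have inj : injective (fun a : 'I_(n i) => (Tagged (fun i => 'I_(n i)) a : T)).
  by move=> a b /eqP; rewrite eq_Tagged /= => /eqP.
rewrite -[RHS]card_ord -(card_imset _ inj); apply: eq_card => x; rewrite inE.
apply/eqP/imsetP => [<-|[a _ ->] //].
by exists (tagged x) => //; case: x.
Qed.

Lemma mem_part i x : (x \in part i) = (tag x == i).
Proof. by rewrite inE. Qed.

Variable G : sgraph T.
Hypothesis GH : subgraph G H.

Lemma adj_tag x y : G x y -> tag x != tag y.
Proof. exact: GH. Qed.

(** Every edge has a unique orientation from a part to the cyclically next one. *)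
Lemma card_edges_cyclic :
  #|edges G| = \sum_i edges_between G (part i) (part (ordS i)).
Proof.
pose P := [set p : T * T | G p.1 p.2 && (tag p.2 == ordS (tag p.1))].
have -> : edges G = [set [set p.1; p.2] | p in P].
  apply/setP => e; apply/imsetP/imsetP => [[[x y]]|[[x y]]]; rewrite !inE /=.
    move=> Gxy ->; case: (ord3_cases (tag x) (tag y)) => h.
    - by move: (adj_tag Gxy); rewrite h eqxx.
    - by exists (x, y); rewrite // /P inE /= Gxy h eqxx.
    - exists (y, x); first by rewrite /P inE /= adj_sym Gxy h ordS3 eqxx.
      by rewrite setUC.
  by case/andP=> Gxy _ ->; exists (x, y); rewrite ?inE.
rewrite card_in_imset; last first.
  move=> [x y] [z t]; rewrite !inE /= => /andP[_ /eqP xy] /andP[_ /eqP zt] E.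
  have : x \in [set z; t] by rewrite -E set21.
  have : y \in [set z; t] by rewrite -E set22.
  rewrite !inE => /orP[] /eqP ey /orP[] /eqP ex; rewrite ex ey // in xy *.
  - by move: (ordS_neq (tag z)); rewrite -xy eqxx.
  - by move: (ordS_ordS_neq (tag z)); rewrite -zt -xy eqxx.
  - by move: (ordS_neq (tag t)); rewrite -xy eqxx.
rewrite -sum1_card (partition_big (fun p : T * T => tag p.1) xpredT) //=.
apply: eq_bigr => i _.
rewrite /edges_between pair_big big_mkcond [RHS]big_mkcond /=.
apply: eq_bigr => -[x y] _; rewrite !inE /=.
case: (tag x =P i) => [->|]; rewrite ?andbF //= ?andbT.
by case: (G x y); case: ifP => //.
Qed.

Lemma card_edges i j k : i != j -> i != k -> j != k ->
  #|edges G| = edges_between G (part i) (part j)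
             + edges_between G (part i) (part k)
             + edges_between G (part j) (part k).
Proof.
move=> ij ik jk; rewrite card_edges_cyclic (ord3_sum _ ij ik jk).
case: (ord3_distinct ij ik jk) => -[ej ek]; subst j k; rewrite !ordS3.
  by rewrite (edges_betweenC G (part i) (part (ordS (ordS i)))); lia.
rewrite (edges_betweenC G (part i) (part (ordS (ordS i)))).
rewrite (edges_betweenC G (part (ordS (ordS i))) (part (ordS i))); lia.
Qed.

Definition nbrs (j : 'I_3) (x : T) : {set T} := [set y in part j | G x y].

Lemma nbrs_sub j x : nbrs j x \subset part j.
Proof. by apply/subsetP => y; rewrite inE => /andP[]. Qed.

Lemma in_nbrs j x y : (y \in nbrs j x) = (tag y == j) && G x y.
Proof. by rewrite !inE. Qed.

Lemma edges_between_nbrs X j :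
  edges_between G X (part j) = \sum_(x in X) #|nbrs j x|.
Proof. by apply: eq_bigr => x _; rewrite sum_adjE. Qed.

End Tripartite.

(** * Copies of the balanced complete tripartite graph *)

Section Copies.
Variables (n : 'I_3 -> nat) (l : nat).
Hypothesis l_gt0 : 0 < l.
Notation T := (vertex n).
Notation H := (complete_tripartite n).
Notation F := (complete_tripartite (fun _ : 'I_3 => l)).

(** The three sides of a copy of [F], indexed by the parts containing them. *)
Definition aligned_copy (R : rel T) (A : 'I_3 -> {set T}) : Prop :=
  [/\ forall i, A i \subset part n i,
      forall i, #|A i| = l &
      forall i j x y, i != j -> x \in A i -> y \in A j -> R x y].

(** A complete tripartite graph has only one proper 3-colouring up to renaming the
    colours, so the parts of the host graph cut a copy into its three sides. *)
Lemma contains_aligned (G : sgraph T) : subgraph G H ->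
  (contains G F <-> exists A, aligned_copy G A).
Proof.
move=> GH; split=> [[f [f_inj f_hom]]|[A [subA cardA homA]]]; last first.
  pose f (u : vertex (fun _ => l)) : T :=
    enum_val (cast_ord (esym (cardA (tag u))) (tagged u)).
  have memA u : f u \in A (tag u) by apply: enum_valP.
  exists f; split=> [[i a] [j b] /= E|u v uv]; last exact: homA uv (memA u) (memA v).
  move: (memA (existT _ j b)) (memA (existT _ i a)); rewrite -E.
  move=> /(subsetP (subA _)); rewrite mem_part => /eqP /= fj.
  move=> /(subsetP (subA _)); rewrite mem_part fj => /eqP ji.
  by clear fj; subst j; have /cast_ord_inj /= -> := enum_val_inj E.
pose r (i : 'I_3) : vertex (fun _ => l) := existT _ i (Ordinal l_gt0).
pose c i := tag (f (r i)).
have c_inj : injective c.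
  move=> i j E; apply/eqP; case: eqP => // /eqP ij.
  have /f_hom/GH : F (r i) (r j) by [].
  by move/negP; case; apply/eqP.
have tag_f u : tag (f u) = c (tag u).
  have [i Ei] : exists i, tag (f u) = c i.
    by exists (invF c_inj (tag (f u))); rewrite f_invF.
  rewrite Ei; congr c; apply/eqP; case: eqP => // /eqP iu.
  have /f_hom/GH : F u (r i) by rewrite /= /complete_tripartite_rel eq_sym.
  by move/negP; case; apply/eqP.
exists (fun t => [set f u | u : vertex (fun _ => l) & tag (f u) == t]).
split=> [t|t|s t x y st].
- by apply/subsetP => x /imsetP[u]; rewrite !inE => ut ->.
- rewrite card_imset //; apply: etrans (card_part (fun _ => l) (invF c_inj t)).
  apply: eq_card => u; rewrite !inE tag_f.
  by rewrite -[RHS](inj_eq c_inj) f_invF.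
- move=> /imsetP[u]; rewrite inE => /eqP us -> /imsetP[v]; rewrite inE => /eqP vt ->.
  apply: f_hom; apply/negP => /eqP uv.
  by move: st; rewrite -us -vt !tag_f uv eqxx.
Qed.

Lemma add_edge_sub (G : sgraph T) (x y : T) :
  subgraph G H -> tag x != tag y -> subgraph (add_edge G x y) H.
Proof.
move=> GH xy u v /orP[/GH //|/andP[uv /eqP E]].
have : u \in [set x; y] by rewrite -E set21.
have : v \in [set x; y] by rewrite -E set22.
rewrite !inE => /orP[] /eqP ev /orP[] /eqP eu; move: uv; rewrite eu ev ?eqxx //.
by move=> _; rewrite /= /complete_tripartite_rel eq_sym.
Qed.

Section Saturated.
Variable G : sgraph T.
Hypothesis satG : saturated_subgraph H F G.
Implicit Types (x y : T) (i j k : 'I_3).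

Lemma saturated_sub : subgraph G H. Proof. by case: satG. Qed.

Lemma saturated_pair (x y : T) : tag x != tag y -> ~~ G x y ->
  exists A : 'I_3 -> {set T}, [/\ forall i, A i \subset part n i,
    forall i, #|A i| = l,
    x \in A (tag x), y \in A (tag y) &
    forall i j u v, i != j -> u \in A i -> v \in A j ->
      [set u; v] != [set x; y] -> G u v].
Proof.
move=> xy nGxy; have [GH freeG /(_ x y xy nGxy)] := satG.
have addH := add_edge_sub GH xy.
move=> /(contains_aligned addH)[A [subA cardA homA]].
have homG i j u v : i != j -> u \in A i -> v \in A j ->
    [set u; v] != [set x; y] -> G u v.
  move=> ij ui vj uv; have := homA i j u v ij ui vj.
  by rewrite /= /add_edge_rel (negbTE uv) andbF orbF.
have inA z : z \in [set x; y] -> z \in A (tag z).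
  move=> zxy; apply: contraT => zA; case: freeG.
  apply/(contains_aligned GH); exists A; split=> // i j u v ij ui vj.
  apply: (homG _ _ _ _ ij ui vj); apply: contra zA => /eqP E.
  have ti w t : w \in A t -> tag w = t.
    by move/(subsetP (subA t)); rewrite mem_part => /eqP.
  by move: zxy; rewrite -E !inE => /orP[] /eqP ->; rewrite ?(ti _ _ ui) ?(ti _ _ vj).
by exists A; split=> //; apply: inA; rewrite !inE eqxx ?orbT.
Qed.

Lemma nonadj_nbrs x y k : tag x != tag y -> tag x != k -> tag y != k ->
  ~~ G x y ->
  exists B C : {set T},
    [/\ B \subset nbrs G (tag y) x :\ y, #|B| = l.-1,
        C \subset nbrs G k x :&: nbrs G k y, #|C| = l &
        forall u v, u \in B -> v \in C -> G u v].
Proof.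
move=> xy xk yk nGxy; have [A [subA cardA xA yA homA]] := saturated_pair xy nGxy.
have ti w t : w \in A t -> tag w = t.
  by move/(subsetP (subA t)); rewrite mem_part => /eqP.
have neq_xy u v : u \in A (tag x) -> v \in A (tag y) -> v != y ->
    [set u; v] != [set x; y].
  move=> ux vy vNy; apply/eqP => E.
  have : v \in [set x; y] by rewrite -E set22.
  rewrite !inE (negbTE vNy) orbF => /eqP vx.
  by move: xy; rewrite -vx (ti _ _ vy) eqxx.
have neq_k u v : v \in A k -> [set u; v] != [set x; y].
  move=> vk; apply/eqP => E.
  have : v \in [set x; y] by rewrite -E set22.
  rewrite !inE => /orP[] /eqP vxy; move: xk yk; rewrite -(ti _ _ vk) vxy eqxx //.
exists (A (tag y) :\ y), (A k); split=> //.
- apply/subsetP => v; rewrite in_setD1 => /andP[vy vA].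
  rewrite in_setD1 vy in_nbrs (ti _ _ vA) eqxx /=.
  by apply: (homA _ _ _ _ xy xA vA); apply: neq_xy.
- by have := cardsD1 y (A (tag y)); rewrite yA cardA => ->.
- apply/subsetP => v vA; rewrite inE !in_nbrs (ti _ _ vA) eqxx /=.
  by apply/andP; split; [apply: (homA _ _ _ _ xk xA vA) | apply: (homA _ _ _ _ yk yA vA)];
    apply: neq_k.
- move=> u v; rewrite in_setD1 => /andP[_ uA] vA.
  by apply: (homA _ _ _ _ yk uA vA); apply: neq_k.
Qed.

Lemma nonadj_common_nbrs x y k : tag x != tag y -> tag x != k -> tag y != k ->
  ~~ G x y -> l <= #|nbrs G k x :&: nbrs G k y|.
Proof.
move=> xy xk yk /(nonadj_nbrs xy xk yk)[B [C [_ _ sC <- _]]].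
exact: subset_leq_card.
Qed.

Hypothesis n_big : forall i, l + l <= n i.

(** A vertex with a nonneighbour in each other part has [l] neighbours in both;
    any other vertex is adjacent to a whole part. *)
Lemma saturated_degree x j k : tag x != j -> tag x != k -> j != k ->
  l + l <= #|nbrs G j x| + #|nbrs G k x|.
Proof.
have one_side a b : tag x != a -> tag x != b -> a != b ->
    l <= #|nbrs G b x| \/ l + l <= #|nbrs G a x|.
  move=> xa xb ab; case: (boolP (part n a \subset nbrs G a x)) => [full|].
    by right; apply: leq_trans (n_big a) _; rewrite -(card_part n a) subset_leq_card.
  case/subsetPn => y; rewrite mem_part in_nbrs => /eqP ya; rewrite ya eqxx /= => nGxy.
  left; have := @nonadj_common_nbrs x y b; rewrite ya => /(_ xa xb ab nGxy) h.
  by apply: leq_trans h (subset_leq_card (subsetIl _ _)).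
move=> xj xk jk; case: (one_side j k xj xk jk) => h1; last by lia.
by case: (one_side k j xk xj _) => [|h2|h2]; rewrite 1?eq_sym //; lia.
Qed.

Lemma disjoint_setD (X Y : {set T}) : [disjoint X :\: Y & Y].
Proof. by rewrite -setI_eq0 setDE -setIA [~: Y :&: Y]setIC setICr setI0. Qed.

(** Each of the [n j - #|N j x|] nonneighbours of [x] in [V j] has [l] common
    neighbours with [x].  In this way all of [V j] is charged to the few
    neighbours of a single vertex of low degree. *)
Lemma edges_to_nbrs x j k : tag x != j -> tag x != k -> j != k ->
  l * n j <= l * #|nbrs G j x|
    + edges_between G (part n j :\: nbrs G j x) (nbrs G k x).
Proof.
move=> xj xk jk; rewrite -leq_subLR -mulnBr.
have <- : #|part n j :\: nbrs G j x| = n j - #|nbrs G j x|.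
  by rewrite cardsD (setIidPr (nbrs_sub _ _ _)) card_part.
apply: edges_between_degree => y; rewrite inE in_nbrs mem_part.
case/andP=> h /eqP yj; move: h; rewrite yj eqxx /= => nGxy.
have := @nonadj_common_nbrs x y k; rewrite yj => /(_ xj xk jk nGxy) h.
rewrite sum_adjE; apply: leq_trans h (subset_leq_card _).
by apply/subsetP => z; rewrite !inE => /andP[/andP[-> ->] /andP[_ ->]].
Qed.

Lemma edges_opposite x j k : tag x != j -> tag x != k -> j != k ->
  l * (n j + n k) <= l * (#|nbrs G j x| + #|nbrs G k x|)
    + edges_between G (part n j) (part n k).
Proof.
move=> xj xk jk; have kj : k != j by rewrite eq_sym.
have := edges_to_nbrs xj xk jk; have := edges_to_nbrs xk xj kj.
have : edges_between G (part n j :\: nbrs G j x) (nbrs G k x)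
     + edges_between G (nbrs G j x) (part n k :\: nbrs G k x)
     <= edges_between G (part n j) (part n k).
  by apply: edges_between_disjoint; rewrite ?subsetDl ?nbrs_sub // disjoint_setD.
rewrite (edges_betweenC G (nbrs G j x)); lia.
Qed.

End Saturated.
End Copies.

(** * Vertices of low degree *)

(** The four inequalities on edge numbers bound [a * w + b * w'] by
    [2 * l * nj + l * (a + b)] up to a term of order [l ^ 2], whereas [w] is at
    least half of [nj] and [w'] exceeds [l]. *)
Lemma arith_few_nbrs (l ni nj nk a b d w w' eij : nat) eik ejk :
  l * ni + a * w <= l * b + eij -> l * ni + b * w' <= l * a + eik ->
  l * (nj + nk) <= l * d + ejk ->
  eij + eik + ejk < 2 * l * ni + 2 * l * nj + 2 * l * nk -> d < 6 * l ->
  nj <= 2 * w -> nk <= 2 * w' -> nk <= nj -> 83 * l <= nk -> a < 5 * l.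
Proof.
move=> Eij Eik Ejk few dl wj wk kj big; rewrite ltnNge; apply/negP => a5.
have h1 : l * b <= b * w' by rewrite mulnC leq_mul2l; lia.
have h2 : l * d <= l * (6 * l) by rewrite leq_mul2l; lia.
have h3 : 5 * l * (w - l) <= a * (w - l) by rewrite leq_mul2r a5 orbT.
have h4 : a * (w - l) + a * l = a * w by rewrite -mulnDr subnK //; lia.
have h5 : 5 * l * (w - l) + 5 * l * l = 5 * l * w by rewrite -mulnDr subnK //; lia.
have h6 : l * nj <= l * (2 * w) by rewrite leq_mul2l wj orbT.
have h7 : l * (83 * l) <= l * nk by rewrite leq_mul2l big orbT.
have h8 : l * nk <= l * nj by rewrite leq_mul2l kj orbT.
have h9 : 0 < l by lia.
have h10 : 0 < l * l by rewrite muln_gt0 h9.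
lia.
Qed.

Section LowDegree.
Variables (n : 'I_3 -> nat) (l : nat).
Hypothesis l_gt0 : 0 < l.
Notation T := (vertex n).
Notation H := (complete_tripartite n).
Notation F := (complete_tripartite (fun _ : 'I_3 => l)).

Variable G : sgraph T.
Hypothesis satG : saturated_subgraph H F G.
(* Both quadratic in [l], to beat the error terms, and at least [83 * l]. *)
Hypothesis n_big : forall i, 72 * l * l + 11 * l <= n i.
Hypothesis few_edges : #|edges G| < 2 * l * \sum_i n i.

Notation "'e_ X Y" := (edges_between G X Y) (at level 10, X at level 9, Y at level 9).
Notation V := (part n).
Notation N := (nbrs G).
Implicit Types (x y : T) (i j k : 'I_3).

Let n_ge2l i : l + l <= n i.
Proof. have := n_big i; nia. Qed.

Let n_gt83 i : 83 * l <= n i.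
Proof. have := n_big i; nia. Qed.

Let n_gt0 i : 0 < n i.
Proof. have := n_gt83 i; lia. Qed.

Lemma few_edges3 i j k : i != j -> i != k -> j != k ->
  'e_ (V i) (V j) + 'e_ (V i) (V k) + 'e_ (V j) (V k)
    < 2 * l * n i + 2 * l * n j + 2 * l * n k.
Proof.
move=> ij ik jk; have := few_edges.
by rewrite (card_edges (saturated_sub satG) ij ik jk) (ord3_sum n ij ik jk) !mulnDr.
Qed.

Lemma degree_sum_ge i j k d (X : {set T}) : X \subset V i ->
  (forall x, x \in X -> d <= #|N j x| + #|N k x|) ->
  d * #|X| <= 'e_ X (V j) + 'e_ X (V k).
Proof.
move=> sX dX; rewrite mulnC -sum_nat_const !edges_between_nbrs -big_split.
exact: leq_sum.
Qed.

Lemma degree_sum_ge2l i j k : i != j -> i != k -> j != k ->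
  2 * l * n i <= 'e_ (V i) (V j) + 'e_ (V i) (V k).
Proof.
move=> ij ik jk; rewrite -(card_part n i); apply: (@degree_sum_ge i) => // x.
rewrite mem_part => /eqP xi; rewrite mul2n -addnn.
by apply: (saturated_degree l_gt0 satG n_ge2l); rewrite ?xi.
Qed.

(** The edges that [y] and [z] force into their neighbours in [V i] come on top
    of all edges at the remaining vertices of [V i]. *)
Lemma edges_off_nbrs i j k y z (W := V i :\: (N i y :|: N i z)) :
  i != j -> i != k -> j != k -> tag y = j -> tag z = k ->
  n i <= #|W| + (#|N i y| + #|N i z|) /\
  l * n j + l * n k + ('e_ W (V j) + 'e_ W (V k))
    <= 'e_ (V i) (V j) + 'e_ (V i) (V k) + l * (#|N k y| + #|N j z|).
Proof.
move=> ij ik jk yj zk.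
have ji : j != i by rewrite eq_sym.
have ki : k != i by rewrite eq_sym.
have kj : k != j by rewrite eq_sym.
split.
  rewrite -(card_part n i) addnC -leq_subLR.
  apply: leq_trans (leq_sub2l _ (_ : #|N i y :|: N i z| <= _)) _.
    by rewrite cardsU leq_subr.
  by rewrite cardsD leq_sub2l // subset_leq_card // subsetIr.
have disjW (X : {set T}) : X \subset N i y :|: N i z -> [disjoint W & X].
  by move=> sX; apply: disjointWr sX _; apply: disjoint_setD.
have Eij : 'e_ W (V j) + 'e_ (N i z) (V j :\: N j z) <= 'e_ (V i) (V j).
  by apply: edges_between_disjoint; rewrite ?subsetDl ?nbrs_sub ?disjW ?subsetUr.
have Eik : 'e_ W (V k) + 'e_ (N i y) (V k :\: N k y) <= 'e_ (V i) (V k).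
  by apply: edges_between_disjoint; rewrite ?subsetDl ?nbrs_sub ?disjW ?subsetUl.
have := @edges_to_nbrs _ _ l_gt0 _ satG z j i.
have := @edges_to_nbrs _ _ l_gt0 _ satG y k i.
rewrite yj zk => /(_ jk ji ki) Ey /(_ kj ki ji) Ez.
rewrite (edges_betweenC G (_ :\: _)) in Ey; rewrite (edges_betweenC G (_ :\: _)) in Ez.
by rewrite -/W mulnDr; lia.
Qed.

(** Once two parts contain vertices [y], [z] with few neighbours, almost all the
    edges that every saturated graph needs meet the third part in the few
    neighbours of [y] and [z], so that the other vertices of that part have
    bounded degree on average.  A vertex [x] of minimum degree among them also
    bounds the edges between the two parts from below, which closes the
    argument. *)
Lemma low_degree_third i j k y z : i != j -> i != k -> j != k ->
  tag y = j -> tag z = k ->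
  4 * (#|N i y| + #|N i z|) <= n i + 24 * l ->
  #|N k y| + #|N j z| <= 11 * l ->
  exists2 x, tag x = i & #|N j x| + #|N k x| < 4 * l.
Proof.
move=> ij ik jk yj zk smallU smallN.
have [] := edges_off_nbrs ij ik jk yj zk.
set W := V i :\: _ => cardW offW.
have [w wW] : exists w, w \in W.
  by apply/card_gt0P; have := n_gt83 i; lia.
pose d x := #|N j x| + #|N k x|.
case: (arg_minnP d wW) => x xW minx.
have xi : tag x = i by move: xW => /setDP[]; rewrite mem_part => /eqP.
exists x => //.
have dW : d x * #|W| <= 'e_ W (V j) + 'e_ W (V k).
  by apply: (@degree_sum_ge i) => //; apply: subsetDl.
have := @edges_opposite _ _ l_gt0 _ satG x j k; rewrite xi => /(_ ij ik jk).
have := few_edges3 ij ik jk; have := n_gt83 i.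
rewrite -/(d x); move: (d x) (#|W|) dW cardW => D w' dW cardW.
rewrite !mulnDr => big few Ex; rewrite ltnNge; apply/negP => Dge.
have : l * (#|N k y| + #|N j z|) <= l * (11 * l) by rewrite leq_mul2l smallN orbT.
have : (D - l) * w' + l * w' = D * w' by rewrite -mulnDl subnK //; lia.
have : 3 * l * w' <= (D - l) * w' by rewrite leq_mul2r; lia.
nia.
Qed.

(** If all degrees in one part were at least [2 l + 1], the surplus would exceed
    the error terms coming from the three low-degree vertices. *)
Lemma exact_degree i j k x y z : i != j -> i != k -> j != k ->
  tag x = i -> tag y = j -> tag z = k ->
  #|N j x| + #|N k x| <= 6 * l -> #|N i y| + #|N k y| <= 6 * l ->
  #|N i z| + #|N j z| <= 6 * l ->
  exists2 x', tag x' = i & #|N j x'| + #|N k x'| = l + l.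
Proof.
move=> ij ik jk xi yj zk dx dy dz.
pose d x := #|N j x| + #|N k x|.
case: (boolP [exists x' : T, (tag x' == i) && (d x' == l + l)]) => [|noex].
  by case/existsP=> x' /andP[/eqP ? /eqP ?]; exists x'.
have [] := edges_off_nbrs ij ik jk yj zk.
set W := V i :\: _ => cardW offW.
have dW : (l + l).+1 * #|W| <= 'e_ W (V j) + 'e_ W (V k).
  apply: (@degree_sum_ge i) => [|w]; first exact: subsetDl.
  move=> /setDP[]; rewrite mem_part => wi _; rewrite ltn_neqAle.
  apply/andP; split.
    by apply: contra noex => /eqP E; apply/existsP; exists w; rewrite wi /d -E eqxx.
  by apply: (saturated_degree l_gt0 satG n_ge2l); rewrite ?(eqP wi).
have := @edges_opposite _ _ l_gt0 _ satG x j k; rewrite xi => /(_ ij ik jk).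
have := few_edges3 ij ik jk; have := n_big i.
move: (#|W|) dW cardW => w dW cardW.
rewrite !mulnDr => big few Ex.
have : w + 12 * l >= n i by lia.
nia.
Qed.

Section LargestPart.
Variables i j k : 'I_3.
Hypotheses (ij : i != j) (ik : i != k) (jk : j != k).
Hypotheses (n_ji : n j <= n i) (n_kj : n k <= n j).

(** The largest part contains at least a third of all vertices, so its average
    degree is below three times [2 * l]. *)
Lemma low_degree_largest :
  exists2 x, tag x = i & #|N j x| + #|N k x| < 6 * l.
Proof.
have [w wV] : exists w, w \in V i by apply/card_gt0P; rewrite card_part.
case: (arg_minnP (fun x => #|N j x| + #|N k x|) wV) => x xV minx.
have /eqP xi : tag x == i by rewrite -mem_part.
exists x => //.
have := degree_sum_ge (subxx (V i)) minx; rewrite card_part.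
have := few_edges3 ij ik jk; move: (_ + #|_|) => D; have := n_gt0 i; nia.
Qed.

(** The edges between the two smaller parts are linear in their sizes, so most
    vertices of these parts have few neighbours in the other smaller part.
    Choosing among those a vertex [y], resp. [z], with the fewest neighbours in
    the largest part makes the degrees into that part count twice: as
    a minimum over a large set, and as the error term of the other choice. *)
Lemma few_nbrs_in_largest :
  exists2 y, tag y = j & 4 * #|N k y| <= n k /\ #|N i y| < 5 * l.
Proof.
have ji : j != i by rewrite eq_sym.
have ki : k != i by rewrite eq_sym.
have kj : k != j by rewrite eq_sym.
have [x xi dx] := low_degree_largest.
have := @edges_opposite _ _ l_gt0 _ satG x j k; rewrite xi => /(_ ij ik jk) Ejk.
have few := few_edges3 ij ik jk.
have Ejk' : 'e_ (V j) (V k) < 4 * l * n j.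
  by have := degree_sum_ge2l ij ik jk; nia.
(* All but a small proportion of the vertices of [V a] are good. *)
pose good a b : {set T} := [set v in V a | 4 * #|N b v| <= n b].
have bad a b : n b * #|V a :\: good a b| <= 4 * 'e_ (V a) (V b).
  rewrite edges_between_nbrs big_distrr /= mulnC -sum_nat_const.
  rewrite big_mkcond [leqRHS]big_mkcond; apply: leq_sum => v _.
  rewrite !inE; case: (tag v == a) => //=; rewrite ?andbF // andbT.
  by case: ifP => //; rewrite -ltnNge => /ltnW.
have badj : 4 * #|V j :\: good j k| <= n j.
  have := bad j k; have := n_gt83 k; nia.
have badk : #|V k :\: good k j| <= 16 * l.
  by have := bad k j; rewrite (edges_betweenC G (V k)); have := n_gt0 j; nia.
have good_sub a b : good a b \subset V a by apply/subsetP => v; rewrite inE => /andP[].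
have card_good a b : #|good a b| + #|V a :\: good a b| = n a.
  by rewrite -(card_part n a) -(cardsID (good a b) (V a)) (setIidPr (good_sub a b)).
have [y0 y0P] : exists y, y \in good j k.
  by apply/card_gt0P; have := card_good j k; have := n_gt0 j; lia.
have [z0 z0P] : exists z, z \in good k j.
  by apply/card_gt0P; have := card_good k j; have := n_gt83 k; lia.
case: (arg_minnP (fun y => #|N i y|) y0P) => y yg miny.
case: (arg_minnP (fun z => #|N i z|) z0P) => z zg minz.
have goodP a b v : v \in good a b -> tag v = a /\ 4 * #|N b v| <= n b.
  by rewrite !inE => /andP[/eqP].
have [yj yk] := goodP _ _ _ yg; have [zk zj] := goodP _ _ _ zg.
exists y => //; split=> //.
have count a b u v : a != i -> b != i -> a != b -> tag v = b ->
    (forall w, w \in good a b -> #|N i u| <= #|N i w|) ->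
    l * n i + #|N i u| * #|good a b :\: N a v|
      <= l * #|N i v| + 'e_ (V i) (V a).
  move=> ai bi ab vb minu.
  have := @edges_to_nbrs _ _ l_gt0 _ satG v i a.
  have ba : b != a by rewrite eq_sym.
  have ia : i != a by rewrite eq_sym.
  rewrite vb => /(_ bi ba ia) Ev.
  have Eu : #|N i u| * #|good a b :\: N a v|
      <= 'e_ (good a b :\: N a v) (V i).
    apply: edges_between_degree => w /setDP[wg _].
    by rewrite sum_adjE; apply: minu.
  have : 'e_ (good a b :\: N a v) (V i) + 'e_ (N a v) (V i :\: N i v)
      <= 'e_ (V a) (V i).
    apply: edges_between_disjoint; rewrite ?subsetDl ?nbrs_sub //.
    - exact: disjoint_setD.
    - by apply: subset_trans (good_sub a b); apply: subsetDl.
  rewrite (edges_betweenC G (N a v) (V i :\: N i v)).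
  rewrite (edges_betweenC G (V a) (V i)).
  by move: Ev Eu; clear; lia.
have Eij := count j k y z ji ki jk zk miny.
have Eik := count k j z y ki ji kj yj minz.
have large a b v : #|good a b| <= #|good a b :\: N a v| + #|N a v|.
  by rewrite -(cardsID (N a v) (good a b)) addnC leq_add2l subset_leq_card ?subsetIr.
have Wy : n j <= 2 * #|good j k :\: N j z|.
  by move: (large j k z) (card_good j k) badj zj; clear; lia.
have Wz : n k <= 2 * #|good k j :\: N k y|.
  by move: (large k j y) (card_good k j) badk yk (n_gt83 k); clear; lia.
exact: (arith_few_nbrs Eij Eik Ejk few dx Wy Wz n_kj (n_gt83 k)).
Qed.

(** The vertex provided by [few_nbrs_in_largest] only has a small proportion of
    [V k] as neighbours; this is enough to find a vertex of low degree in [V k],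
    which in turn leads to one in [V j]. *)
Lemma low_degree_all : exists x y z,
  [/\ tag x = i, tag y = j & tag z = k] /\
  [/\ #|N j x| + #|N k x| <= 6 * l, #|N i y| + #|N k y| <= 6 * l &
      #|N i z| + #|N j z| <= 6 * l].
Proof.
have ji : j != i by rewrite eq_sym.
have ki : k != i by rewrite eq_sym.
have kj : k != j by rewrite eq_sym.
have [x xi dx] := low_degree_largest.
have [y yj [yk yi]] := few_nbrs_in_largest.
have [z zk dz] : exists2 z, tag z = k & #|N i z| + #|N j z| < 4 * l.
  by apply: (low_degree_third ki kj ij xi yj); lia.
have [y' y'j dy'] : exists2 y', tag y' = j & #|N i y'| + #|N k y'| < 4 * l.
  by have := n_gt83 j; move=> ?; apply: (low_degree_third ji jk ik xi zk); lia.
exists x, y', z; split; split=> //; lia.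
Qed.

Lemma exact_degree_all : exists x : 'I_3 -> T,
  forall a, tag (x a) = a /\
    forall b c, a != b -> a != c -> b != c -> #|N b (x a)| + #|N c (x a)| = l + l.
Proof.
have ji : j != i by rewrite eq_sym.
have ki : k != i by rewrite eq_sym.
have kj : k != j by rewrite eq_sym.
have [x [y [z [[xi yj zk] [dx dy dz]]]]] := low_degree_all.
have [x' x'i dx'] := exact_degree ij ik jk xi yj zk dx dy dz.
rewrite addnC in dz.
have [y' y'j dy'] := exact_degree ji jk ik yj xi zk dy dx dz.
rewrite addnC in dx; rewrite addnC in dy; rewrite addnC in dz.
have [z' z'k dz'] := exact_degree ki kj ij zk xi yj dz dx dy.
have sym a b c b' c' v : a != b -> a != c -> b != c ->
    #|N b v| + #|N c v| = l + l -> a != b' -> a != c' -> b' != c' ->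
    #|N b' v| + #|N c' v| = l + l.
  move=> ab ac bc + ab' ac' bc'.
  by case: (ord3_distinct ab ac bc) => -[-> ->];
    case: (ord3_distinct ab' ac' bc') => -[-> ->] //; rewrite addnC.
exists (fun a => if a == i then x' else if a == j then y' else z') => a.
have [->|[->|->]] : a = i \/ (a = j \/ a = k).
  by case: (ord3_distinct ij ik jk) => -[-> ->]; case: (ord3_cases i a) => ->; auto.
- by rewrite eqxx; split=> // b c; apply: sym dx'.
- by rewrite (negbTE ji) eqxx; split=> // b c; apply: sym dy'.
- by rewrite (negbTE ki) (negbTE kj); split=> // b c; apply: sym dz'.
Qed.

End LargestPart.

End LowDegree.

(** * Hub configurations *)

(** Inclusion-exclusion: [A * Y] and [X * B] overlap in [A * B], and one further
    pair is missing. *)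
Lemma sum_hub_pairs (T : finType) (X Y A B : {set T}) (u v : T) :
  A \subset X -> B \subset Y -> u \in A -> v \in B ->
  \sum_(x in X) \sum_(y in Y)
     ((((x \in A) || (y \in B)) && ~~ ((x == u) && (y == v))) : nat)
    + #|A| * #|B| + 1 = #|A| * #|Y| + #|X| * #|B|.
Proof.
move=> sAX sBY uA vB.
have mem_sum (Z C : {set T}) : C \subset Z -> \sum_(z in Z) ((z \in C) : nat) = #|C|.
  move=> sCZ; rewrite sum_nat_of_mem; apply: eq_card => z; rewrite inE.
  by case: (boolP (z \in C)) => [/(subsetP sCZ) ->|_]; rewrite ?andbF.
have eq_sum (Z : {set T}) z0 : z0 \in Z -> \sum_(z in Z) ((z == z0) : nat) = 1.
  move=> zZ; rewrite -[RHS](cards1 z0) -(mem_sum Z) ?sub1set //.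
  by apply: eq_bigr => z _; rewrite inE.
have sum_prod (f g : T -> nat) : \sum_(x in X) \sum_(y in Y) f x * g y
    = (\sum_(x in X) f x) * \sum_(y in Y) g y.
  by rewrite big_distrlr.
have -> : 1 = \sum_(x in X) \sum_(y in Y) (x == u) * (y == v).
  by rewrite sum_prod !eq_sum ?(subsetP sAX) ?(subsetP sBY).
have -> : #|A| * #|B| = \sum_(x in X) \sum_(y in Y) (x \in A) * (y \in B).
  by rewrite sum_prod !mem_sum.
have -> : #|A| * #|Y| = \sum_(x in X) \sum_(y in Y) (x \in A) * 1.
  by rewrite sum_prod mem_sum // sum1_card.
have -> : #|X| * #|B| = \sum_(x in X) \sum_(y in Y) 1 * (y \in B).
  by rewrite sum_prod mem_sum // sum1_card.
rewrite -!big_split; apply: eq_bigr => x _; rewrite -!big_split; apply: eq_bigr => y _ /=.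
case: (x =P u) => [->|_]; case: (y =P v) => [->|_]; rewrite ?uA ?vB //;
  by case: (x \in A); case: (y \in B); rewrite ?uA ?vB; case: (u \in A); case: (v \in B).
Qed.

Section HubConfig.
Variables (n : 'I_3 -> nat) (l : nat).
Notation T := (vertex n).
Notation H := (complete_tripartite n).
Notation F := (complete_tripartite (fun _ : 'I_3 => l)).
Notation V := (part n).
Implicit Types (x y : T) (i j k : 'I_3).

(** For [i != j] the vertices [p i j] and [p j i] are the ends, in the parts [i]
    and [j], of the missing edge between the hubs of these parts; the values
    [p i i] carry no information. *)
Definition hub_config (G : sgraph T) (S : {set T}) (p : 'I_3 -> 'I_3 -> T) :=
  [/\ forall i, #|S :&: V i| = l,
      forall i j, i != j -> p i j \in S :&: V i &
      forall x y, G x y =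
        [&& tag x != tag y, (x \in S) || (y \in S)
          & ~~ ((x == p (tag x) (tag y)) && (y == p (tag y) (tag x)))]].

Lemma hub_config_sub G S p : hub_config G S p -> subgraph G H.
Proof. by case=> _ _ GE x y; rewrite GE => /and3P[]. Qed.

Lemma hub_config_edges G S p : hub_config G S p ->
  #|edges G| + 3 * l ^ 2 + 3 = 2 * l * \sum_i n i.
Proof.
move=> hub; have [cS pS GE] := hub.
rewrite (card_edges_cyclic (hub_config_sub hub)).
have pair i j : i != j ->
    edges_between G (V i) (V j) + l * l + 1 = l * n j + n i * l.
  move=> ij; have ji : j != i by rewrite eq_sym.
  have := sum_hub_pairs (subsetIr S (V i)) (subsetIr S (V j)) (pS _ _ ij) (pS _ _ ji).
  rewrite !cS !card_part => <-.
  do 2 congr (_ + _); apply: eq_bigr => x xi; apply: eq_bigr => y yj.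
  rewrite GE !in_setI xi yj !andbT.
  by move: xi yj; rewrite !mem_part => /eqP -> /eqP ->; rewrite ij.
rewrite !ord3_sum_cyclic ordS3.
have Ei i : edges_between G (V i) (V (ordS i)) + l * l + 1 = l * n (ordS i) + n i * l.
  by apply: pair; rewrite eq_sym ordS_neq.
have := Ei ord0; have := Ei (ordS ord0); have := Ei (ordS (ordS ord0)).
rewrite ordS3; move: (edges_between _ _ _) (edges_between _ _ _) (edges_between _ _ _).
move: (n _) (n _) (n _); clear; lia.
Qed.

(** Two vertices outside [S] complete to a copy only if deleting one hub from each
    of their parts destroys all missing edges.  The hub deleted in part [i] has to
    be [p i k] and that in part [j] has to be [p j k], because the copy contains
    all hubs of part [k]; so one of the two must also lie on the missing edge
    between [i] and [j]. *)
Definition linked (p : 'I_3 -> 'I_3 -> T) :=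
  forall i j k, i != j -> i != k -> j != k -> p i j = p i k \/ p j i = p j k.

Hypothesis l_gt0 : 0 < l.
Hypothesis n_big : forall i, l + l <= n i.

Lemma aligned_copy3 (R : rel T) i j k (A B C : {set T}) : symmetric R ->
  i != j -> i != k -> j != k ->
  A \subset V i -> B \subset V j -> C \subset V k ->
  #|A| = l -> #|B| = l -> #|C| = l ->
  (forall x y, x \in A -> y \in B -> R x y) ->
  (forall x y, x \in A -> y \in C -> R x y) ->
  (forall x y, x \in B -> y \in C -> R x y) ->
  exists A, aligned_copy l R A.
Proof.
move=> symR ij ik jk sA sB sC cA cB cC AB AC BC.
have ji : (j == i) = false by rewrite eq_sym (negbTE ij).
have ki : (k == i) = false by rewrite eq_sym (negbTE ik).
have kj : (k == j) = false by rewrite eq_sym (negbTE jk).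
have cases t : [\/ t = i, t = j | t = k].
  by case: (ord3_distinct ij ik jk) => -[-> ->]; case: (ord3_cases i t) => ->;
    [constructor 1|constructor 2|constructor 3|constructor 1|constructor 3|constructor 2].
exists (fun t => if t == i then A else if t == j then B else C).
split=> [t|t|s t x y].
- by case: (cases t) => ->; rewrite ?eqxx ?ji ?ki ?kj.
- by case: (cases t) => ->; rewrite ?eqxx ?ji ?ki ?kj.
- case: (cases s) => ->; case: (cases t) => ->; rewrite ?eqxx ?ji ?ki ?kj // => _ xs yt;
    by [auto | rewrite symR; auto].
Qed.

Lemma hub_config_saturated G S p :
  hub_config G S p -> linked p -> saturated_subgraph H F G.
Proof.
move=> hub link; have [cS pS GE] := hub; have GH := hub_config_sub hub.
have pSi i j : i != j -> p i j \in S by move/pS/setIP=> [].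
have pt i j : i != j -> tag (p i j) = i.
  by move/pS/setIP=> [_]; rewrite mem_part => /eqP.
have p_nadj i j : i != j -> ~~ G (p i j) (p j i).
  move=> ij; rewrite GE !pt ?ij // 1?eq_sym // !eqxx /= andbF //.
split=> //.
  (* Non-hubs are pairwise nonadjacent, so two of the three sides of a copy consist
     of all hubs of their parts; but these span a missing edge. *)
  move/(contains_aligned l_gt0 GH) => [A [sA cA homA]].
  have off i j : i != j -> A i \subset S \/ A j \subset S.
    move=> ij; case: (boolP (A i \subset S)) => [|/subsetPn[x xi xS]]; first by left.
    right; apply/subsetP => y yj; have := homA i j x y ij xi yj.
    by rewrite GE (negbTE xS) => /and3P[].
  have full i : A i \subset S -> A i = S :&: V i.
    by move=> AS; apply/eqP; rewrite eqEcard subsetI AS sA cS cA leqnn.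
  have clash i j : i != j -> A i \subset S -> A j \subset S -> False.
    move=> ij Ai Aj; have /negP := p_nadj i j ij; apply.
    by apply: (homA i j) => //; rewrite full ?pS // eq_sym.
  pose a : 'I_3 := ord0; pose b := ordS a; pose c := ordS b.
  have ab : a != b by [].
  have ac : a != c by [].
  have bc : b != c by [].
  have [Aa|Ab] := off a b ab.
    by have [Ab|Ac] := off b c bc; [apply: clash ab _ _ | apply: clash ac _ _].
  by have [Aa|Ac] := off a c ac; [apply: clash ab _ _ | apply: clash bc _ _].
move=> x y; rewrite -[H x y]/(tag x != tag y) => xy nGxy.
apply/(contains_aligned l_gt0 (add_edge_sub GH xy)).
have addP u v : u \in [set x; y] -> v \in [set x; y] -> u != v -> add_edge G x y u v.
  rewrite /= /add_edge_rel !inE => /orP[] /eqP -> /orP[] /eqP ->;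
    by rewrite ?eqxx //= => ->; rewrite ?(setUC [set y]) ?eqxx ?orbT.
have [k xk yk] := ord3_third xy.
have [i xi] : exists i, tag x = i by exists (tag x).
have [j yj] : exists j, tag y = j by exists (tag y).
rewrite xi yj in xy xk yk.
have ji : j != i by rewrite eq_sym.
have ki : k != i by rewrite eq_sym.
have kj : k != j by rewrite eq_sym.
have inV t z : (z \in S :&: V t) = (z \in S) && (tag z == t) by rewrite inE mem_part.
case: (boolP ((x \in S) || (y \in S))) => [xyS|]; last first.
  (* Neither end is a hub: all hubs of part [k], and all but one hub of the two
     other parts, complete the new edge to a copy. *)
  rewrite negb_or => /andP[xS yS].
  have cardD t z w : t != z -> w \notin S -> #|w |: (S :&: V t) :\ p t z| = l.
    move=> tz wS; rewrite cardsU1 in_setD1 inV (negbTE wS) andbF add1n.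
    by have := cardsD1 (p t z) (S :&: V t); rewrite pS // cS.
  apply: (aligned_copy3 (i := i) (j := j) (k := k)
     (A := x |: (S :&: V i) :\ p i k) (B := y |: (S :&: V j) :\ p j k)
     (C := S :&: V k)) => //.
  - exact: (adj_sym (add_edge G x y)).
  - apply/subsetP => z; rewrite in_setU1 in_setD1 inV mem_part.
    by case/orP=> [/eqP ->|/and3P[]//]; rewrite xi.
  - apply/subsetP => z; rewrite in_setU1 in_setD1 inV mem_part.
    by case/orP=> [/eqP ->|/and3P[]//]; rewrite yj.
  - exact: subsetIr.
  - exact: cardD.
  - exact: cardD.
  - move=> u v; rewrite !in_setU1 !in_setD1 !inV.
    case/orP=> [/eqP ->|/and3P[uk uS /eqP ui]];
      case/orP=> [/eqP ->|/and3P[vk vS /eqP vj]].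
    + apply: addP; rewrite ?inE ?eqxx ?orbT //.
      by apply: contra xy => /eqP e; rewrite -xi -yj e.
    + apply/orP; left; rewrite GE xi vj xy vS orbT /=.
      by apply: contra xS => /andP[/eqP -> _]; apply: pSi.
    + apply/orP; left; rewrite GE ui yj xy uS /=.
      by apply: contra yS => /andP[_ /eqP ->]; apply: pSi.
    + apply/orP; left; rewrite GE ui vj xy uS /=; apply/negP => /andP[/eqP eu /eqP ev].
      by have [E|E] := link i j k xy xk yk; [move: uk | move: vk];
        rewrite ?eu ?ev ?E eqxx.
  - move=> u v; rewrite in_setU1 in_setD1 !inV => Hu /andP[vS /eqP vk].
    apply/orP; left; case/orP: Hu => [/eqP ->|/and3P[uk uS /eqP ui]].
      rewrite GE xi vk xk vS orbT /=.
      by apply: contra xS => /andP[/eqP -> _]; apply: pSi.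
    by rewrite GE ui vk xk uS /= (negbTE uk).
  - move=> u v; rewrite in_setU1 in_setD1 !inV => Hu /andP[vS /eqP vk].
    apply/orP; left; case/orP: Hu => [/eqP ->|/and3P[uk uS /eqP uj]].
      rewrite GE yj vk yk vS orbT /=.
      by apply: contra yS => /andP[/eqP -> _]; apply: pSi.
    by rewrite GE uj vk yk uS /= (negbTE uk).
(* The pair is one of the three missing edges.  All hubs of its two parts
   together with any [l] non-hubs of the third part form a copy. *)
have [xp yp] : x = p i j /\ y = p j i.
  by move: nGxy; rewrite GE xi yj xy xyS /= negbK => /andP[/eqP ? /eqP ?].
have [C sC cC] : exists2 C : {set T}, C \subset V k :\: S & #|C| = l.
  have : l <= #|V k :\: S|.
    by rewrite cardsD setIC cS card_part; have := n_big k; lia.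
  case/card_geqP => s [us <- sVS]; exists [set z in s]; last first.
    by rewrite -(card_uniqP us); apply: eq_card => z; rewrite inE.
  by apply/subsetP => z; rewrite inE; apply: sVS.
have inC z : z \in C -> z \notin S /\ tag z = k.
  by move/(subsetP sC)/setDP=> [+ ?]; rewrite mem_part => /eqP.
apply: (aligned_copy3 (i := i) (j := j) (k := k)
   (A := S :&: V i) (B := S :&: V j) (C := C)) => //; rewrite ?subsetIr //.
- exact: (adj_sym (add_edge G x y)).
- by apply: subset_trans sC (subsetDl _ _).
- move=> u v; rewrite !inV => /andP[uS /eqP ui] /andP[vS /eqP vj].
  have [/andP[/eqP eu /eqP ev]|ne] := boolP ((u == x) && (v == y)).
    apply: addP; rewrite ?eu ?ev ?inE ?eqxx ?orbT //.
    by apply: contra xy => /eqP E; rewrite -xi -yj E.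
  by apply/orP; left; rewrite GE ui vj xy uS -xp -yp ne.
- move=> u v; rewrite inV => /andP[uS /eqP ui] /inC[vS vk].
  apply/orP; left; rewrite GE ui vk xk uS /=.
  by apply: contra vS => /andP[_ /eqP ->]; apply: pSi.
- move=> u v; rewrite inV => /andP[uS /eqP uj] /inC[vS vk].
  apply/orP; left; rewrite GE uj vk yk uS /=.
  by apply: contra vS => /andP[_ /eqP ->]; apply: pSi.
Qed.

Lemma saturated_linked G S p :
  hub_config G S p -> saturated_subgraph H F G -> linked p.
Proof.
move=> hub satG i j k ij ik jk; have [cS pS GE] := hub.
have ji : j != i by rewrite eq_sym.
have ki : k != i by rewrite eq_sym.
have kj : k != j by rewrite eq_sym.
have pt a b : a != b -> p a b \in S /\ tag (p a b) = a.
  by move/pS/setIP=> [?]; rewrite mem_part => /eqP.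
have off a : exists2 z, tag z = a & z \notin S.
  have /card_gt0P[z /setDP[]] : 0 < #|V a :\: S|.
    by rewrite cardsD setIC cS card_part; have := n_big a; lia.
  by rewrite mem_part => /eqP ? ?; exists z.
have [x xi xS] := off i; have [y yj yS] := off j.
have xy : tag x != tag y by rewrite xi yj.
have nGxy : ~~ G x y by rewrite GE (negbTE xS) (negbTE yS) andbF.
have [A [sA cA xA yA homA]] := saturated_pair l_gt0 satG xy nGxy.
rewrite xi in xA; rewrite yj in yA.
have tA z t : z \in A t -> tag z = t.
  by move/(subsetP (sA t)); rewrite mem_part => /eqP.
have ne_k u v : v \in A k -> [set u; v] != [set x; y].
  move=> /tA vk; apply/eqP => E; have : v \in [set x; y] by rewrite -E set22.
  by rewrite !inE => /orP[] /eqP e; move: ki kj; rewrite -vk e ?xi ?yj eqxx.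
have ne_S u v : u \in S -> [set u; v] != [set x; y].
  move=> uS; apply/eqP => E; have : u \in [set x; y] by rewrite -E set21.
  by rewrite !inE => /orP[] /eqP e; move: xS yS; rewrite -e uS.
have Ak : A k = S :&: V k.
  apply/eqP; rewrite eqEcard cA cS leqnn andbT subsetI sA andbT.
  apply/subsetP => v vk; have := homA i k x v ik xA vk (ne_k _ _ vk).
  by rewrite GE (negbTE xS) => /and3P[].
(* The side in [V a] loses only the hub [p a k], which is not adjacent to the
   hub [p k a] of the side in [V k]. *)
have inA a b z w : a != b -> a != k -> z \in A a -> z \notin S ->
    w \in A b -> w \notin S -> [set z; w] = [set x; y] ->
    p a b != p a k -> p a b \in A a.
  move=> ab ak zA zS wA wS Ezw pab.
  have pS' u : u != z -> u \in A a -> u \in S.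
    move=> uz uA; have := homA a b u w ab uA wA.
    rewrite GE (negbTE wS) orbF -Ezw => h; have /h/and3P[] // : [set u; w] != [set z; w].
    apply/eqP => E; have : u \in [set z; w] by rewrite -E set21.
    rewrite !inE (negbTE uz) => /eqP uw.
    by move: ab; rewrite -(tA _ _ uA) -(tA _ _ wA) uw eqxx.
  have pak : p a k \notin A a.
    have ka : k != a by rewrite eq_sym.
    apply/negP => pA; have [kS tk] := pt k a ka; have [aS ta] := pt a k ak.
    have := homA a k (p a k) (p k a) ak pA.
    rewrite Ak pS // => /(_ isT (ne_S _ _ aS)).
    by rewrite GE ta tk !eqxx !andbF.
  have : p a b \in A a :\ z; last by move/setD1P=> [].
  suff -> : A a :\ z = (S :&: V a) :\ p a k by rewrite in_setD1 pab pS.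
  apply/eqP; rewrite eqEcard; apply/andP; split.
    apply/subsetP => u /setD1P[uz uA]; rewrite in_setD1 inE (pS' _ uz uA).
    rewrite (subsetP (sA a) _ uA) !andbT.
    by apply: contra pak => /eqP <-.
  by have := cardsD1 z (A a); have := cardsD1 (p a k) (S :&: V a);
    rewrite zA pS // cA cS => -> /addnI ->.
case: (p i j =P p i k) => [|/eqP pi]; first by left.
case: (p j i =P p j k) => [|/eqP pj]; first by right.
have pij := inA i j x y ij ik xA xS yA yS erefl pi.
have pji := inA j i y x ji jk yA yS xA xS (setUC _ _) pj.
have [iS ti] := pt i j ij; have [jS tj] := pt j i ji.
have := homA i j _ _ ij pij pji (ne_S _ _ iS).
by rewrite GE ti tj !eqxx !andbF.
Qed.
End HubConfig.

(** * Vertices of degree exactly 2l *)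

Section ExactDegree.
Variables (n : 'I_3 -> nat) (l : nat).
Hypothesis l_gt0 : 0 < l.
Notation T := (vertex n).
Notation H := (complete_tripartite n).
Notation F := (complete_tripartite (fun _ : 'I_3 => l)).
Notation V := (part n).
Implicit Types (x y : T) (i j k : 'I_3).

Variable G : sgraph T.
Hypothesis satG : saturated_subgraph H F G.
Hypothesis n_big : forall i, l + l < n i.
Notation N := (nbrs G).

Lemma exact_degree_half x j k : tag x != j -> tag x != k -> j != k ->
  #|N j x| + #|N k x| = l + l -> l <= #|N k x|.
Proof.
move=> xj xk jk dx.
have /card_gt0P[y /setDP[]] : 0 < #|V j :\: N j x|.
  by rewrite cardsD (setIidPr (nbrs_sub _ _ _)) card_part; have := n_big j; lia.
rewrite mem_part in_nbrs => /eqP yj; rewrite yj eqxx /= => nGxy.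
have := @nonadj_common_nbrs _ _ l_gt0 _ satG x y k; rewrite yj => /(_ xj xk jk nGxy) h.
exact: leq_trans h (subset_leq_card (subsetIl _ _)).
Qed.

(** The copy created by joining [x] to a vertex outside [N j x] uses all of
    [N k x] and all but one vertex of [N j x]. *)
Lemma exact_degree_nbrs x j k : tag x != j -> tag x != k -> j != k ->
  #|N j x| = l -> #|N k x| = l ->
  exists2 p, p \in N j x &
    (forall u v, u \in N j x -> v \in N k x -> u != p -> G u v) /\
    (forall u v, u \in V j -> u \notin N j x -> v \in N k x -> G u v).
Proof.
move=> xj xk jk dj dk.
have new y : y \in V j -> y \notin N j x -> tag y = j /\ ~~ G x y.
  by rewrite mem_part in_nbrs => /eqP yj; rewrite yj eqxx.
have /card_gt0P[y /setDP[yV yN]] : 0 < #|V j :\: N j x|.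
  by rewrite cardsD (setIidPr (nbrs_sub _ _ _)) card_part dj; have := n_big j; lia.
have [yj nGxy] := new y yV yN.
have := @nonadj_nbrs _ _ l_gt0 _ satG x y k; rewrite yj => /(_ xj xk jk nGxy).
case=> B [C [sB cB sC cC BC]].
have EC : C = N k x.
  by apply/eqP; rewrite eqEcard cC dk leqnn andbT (subset_trans sC) ?subsetIl.
have sB' : B \subset N j x by apply: subset_trans sB (subsetDl _ _).
have /card_gt0P[p /setDP[pN pB]] : 0 < #|N j x :\: B|.
  by rewrite cardsD (setIidPr sB') dj cB; lia.
have EB : B = N j x :\ p.
  apply/eqP; rewrite eqEcard; apply/andP; split.
    apply/subsetP => u uB; rewrite in_setD1 (subsetP sB') // andbT.
    by apply: contra pB => /eqP <-.
  by have := cardsD1 p (N j x); rewrite pN dj cB => ->.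
exists p => //; split=> [u v uN vN up|u v uV uN vN].
  by apply: BC; rewrite ?EC // EB in_setD1 up.
have [uj nGxu] := new u uV uN.
have := @nonadj_common_nbrs _ _ l_gt0 _ satG x u k; rewrite uj => /(_ xj xk jk nGxu) h.
have /setIidPl E : N k x \subset N k u.
  by rewrite -dk in h; apply/setIidPl/eqP; rewrite eqEcard h subsetIl.
by move: vN; rewrite -E inE in_nbrs => /andP[_]; rewrite in_nbrs => /andP[].
Qed.

(** The two one-sided statements together: the missing pairs all contain [p] and
    all contain [q], so there is at most one. *)
Lemma exact_degree_pairs x j k : tag x != j -> tag x != k -> j != k ->
  #|N j x| + #|N k x| = l + l ->
  [/\ #|N j x| = l, #|N k x| = l &
  exists p q, [/\ p \in N j x, q \in N k x &
    forall u v, u \in V j -> v \in V k ->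
    ((u \in N j x) || (v \in N k x)) && ~~ ((u == p) && (v == q)) -> G u v]].
Proof.
move=> xj xk jk dx; have kj : k != j by rewrite eq_sym.
have hk := exact_degree_half xj xk jk dx.
have hj := exact_degree_half xk xj kj (etrans (addnC _ _) dx).
have dj : #|N j x| = l by lia.
have dk : #|N k x| = l by lia.
split=> //.
have [p pN [hp hp']] := exact_degree_nbrs xj xk jk dj dk.
have [q qN [hq hq']] := exact_degree_nbrs xk xj kj dk dj.
exists p, q; split=> // u v uV vV /andP[].
case: (boolP (u \in N j x)) => uN; case: (boolP (v \in N k x)) => vN //= _.
- rewrite negb_and => /orP[up|vq]; first exact: hp.
  by rewrite adj_sym; apply: hq.
- by move=> _; rewrite adj_sym; apply: hq'.
- by move=> _; apply: hp'.
Qed.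

Variable x : 'I_3 -> T.
Hypothesis xP : forall a, tag (x a) = a /\
  forall b c, a != b -> a != c -> b != c -> #|N b (x a)| + #|N c (x a)| = l + l.

Let third i := ordS (ordS i).

Let x_nbrs i : exists pq : T * T,
  [/\ #|N i (x (third i))| = l, #|N (ordS i) (x (third i))| = l,
      pq.1 \in N i (x (third i)), pq.2 \in N (ordS i) (x (third i)) &
    forall u v, u \in V i -> v \in V (ordS i) ->
    ((u \in N i (x (third i))) || (v \in N (ordS i) (x (third i))))
      && ~~ ((u == pq.1) && (v == pq.2)) -> G u v].
Proof.
have [tx dx] := xP (third i).
have h1 : third i != i by apply: ordS_ordS_neq.
have h2 : third i != ordS i by apply: ordS_neq.
have h3 : i != ordS i by rewrite eq_sym ordS_neq.
have := @exact_degree_pairs (x (third i)) i (ordS i).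
rewrite tx => /(_ h1 h2 h3 (dx _ _ h1 h2 h3)) [c1 c2 [p [q [pN qN hpq]]]].
by exists (p, q).
Qed.

(** Between each two parts the graph contains the hub pattern around
    a vertex of degree [2 l] in the third part.  Three such patterns already have
    the claimed number of edges, and in case of equality there is nothing else;
    the hubs seen from two different parts then agree, because a hub has too
    large a degree to be one of the vertices [x i]. *)
Lemma exact_degree_hub :
  2 * l * \sum_i n i <= #|edges G| + 3 * l ^ 2 + 3 /\
  (#|edges G| + 3 * l ^ 2 + 3 = 2 * l * \sum_i n i ->
    exists S p, hub_config l G S p).
Proof.
have [pq pqP] := fin_all_exists x_nbrs.
pose A i := N i (x (third i)); pose B i := N (ordS i) (x (third i)).
pose M i (u v : T) := ((u \in A i) || (v \in B i))
  && ~~ ((u == (pq i).1) && (v == (pq i).2)).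
have MG i u v : u \in V i -> v \in V (ordS i) -> (M i u v : nat) <= G u v.
  by move=> uV vV; have [_ _ _ _ /(_ u v uV vV)] := pqP i; rewrite -/(M i u v);
    case: (M i u v) => // ->.
pose m i := \sum_(u in V i) \sum_(v in V (ordS i)) (M i u v : nat).
have mE i : m i + l * l + 1 = l * n (ordS i) + n i * l.
  have [cA cB pA qB _] := pqP i.
  have := sum_hub_pairs (nbrs_sub G i (x (third i)))
            (nbrs_sub G (ordS i) (x (third i))) pA qB.
  by rewrite cA cB !card_part.
have m_le i : m i <= edges_between G (V i) (V (ordS i)).
  by apply: leq_sum => u uV; apply: leq_sum => v vV; apply: MG.
have sum_m : \sum_i m i + 3 * l ^ 2 + 3 = 2 * l * \sum_i n i.
  rewrite !ord3_sum_cyclic; move: (mE ord0) (mE (ordS ord0)) (mE (ordS (ordS ord0))).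
  by rewrite ordS3; move: (m _) (m _) (m _) (n _) (n _) (n _); clear; lia.
have le_m : \sum_i m i <= #|edges G|.
  by rewrite (card_edges_cyclic (saturated_sub satG)); apply: leq_sum => i _.
split=> [|edgesE]; first by rewrite -sum_m -!addnA leq_add2r.
have eq_m i : m i = edges_between G (V i) (V (ordS i)).
  apply: leq_sum_all_eq m_le _ i.
  by rewrite -(card_edges_cyclic (saturated_sub satG)); move: edgesE sum_m; clear; lia.
have GM i u v : u \in V i -> v \in V (ordS i) -> G u v = M i u v.
  move=> uV vV.
  pose f (w : T * T) := if (w.1 \in V i) && (w.2 \in V (ordS i)) then M i w.1 w.2 : nat else 0.
  pose g (w : T * T) := if (w.1 \in V i) && (w.2 \in V (ordS i)) then G w.1 w.2 : nat else 0.
  have le_fg w : f w <= g w by rewrite /f /g; case: ifP => // /andP[? ?]; apply: MG.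
  have E : (M i u v : nat) = G u v.
    have := leq_sum_all_eq le_fg _ (u, v); rewrite /f /g /= uV vV /= => -> //.
    have := eq_m i; rewrite /m /edges_between !pair_big -!big_mkcond /= => ->.
    exact: leqnn.
  by case: (G u v) (M i u v) E => [] [].
have S3 i : third (ordS i) = i by apply: ordS3.
have EB i : B i = A (ordS i).
  have [cA cB pA qB _] := pqP i; have [cA' _ _ _ _] := pqP (ordS i).
  rewrite /A S3 in cA' *; have [tx _] := xP i.
  have xV : x i \in V i by rewrite mem_part tx.
  have xA : x i \notin A i.
    apply/negP => xA; suff : n (ordS i) <= l.+1 by have := n_big (ordS i); lia.
    rewrite -cA' -(card_part n) (cardsD1 (pq i).2 (V _)).
    rewrite -[leqRHS]add1n leq_add ?leq_b1 //.
    apply: subset_leq_card; apply/subsetP => v /setD1P[vq vV].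
    by rewrite in_nbrs -mem_part vV (GM i) // /M xA (negbTE vq) andbF.
  apply/setP => v; case: (boolP (v \in V (ordS i))) => vV; last first.
    by rewrite ![v \in _](negbTE (contra (subsetP (nbrs_sub _ _ _) v) vV)).
  rewrite [RHS]in_nbrs -mem_part vV (GM i) // /M (negbTE xA) /=.
  have -> : x i == (pq i).1 = false; last by rewrite andbT.
  by apply: contraNF xA => /eqP ->.
pose S : {set T} := [set u | u \in A (tag u)].
have SV i : S :&: V i = A i.
  apply/setP => u; rewrite inE mem_part inE.
  case: (tag u =P i) => [->|/eqP ui]; rewrite ?andbT // andbF.
  by apply/esym/negP => /(subsetP (nbrs_sub _ _ _)); rewrite mem_part; apply/negP.
have SA u : (u \in S) = (u \in A (tag u)) by rewrite inE.
pose p s t := if t == ordS s then (pq s).1 else (pq t).2.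
have pS i : p i (ordS i) = (pq i).1 by rewrite /p eqxx.
have pS' i : p (ordS i) i = (pq i).2.
  by rewrite /p; case: eqP => // E; move: (ordS_ordS_neq i); rewrite -E eqxx.
have GE u v : tag v = ordS (tag u) -> G u v =
    [&& tag u != tag v, (u \in S) || (v \in S)
      & ~~ ((u == p (tag u) (tag v)) && (v == p (tag v) (tag u)))].
  move=> uv; rewrite (GM (tag u)) ?mem_part ?uv // pS pS' !SA uv -EB.
  by rewrite eq_sym ordS_neq.
exists S, p; split=> [i|i j ij|u v].
- by rewrite SV; have [] := pqP i.
- rewrite SV; case: (ord3_cases i j) ij => ->; rewrite ?eqxx // => _.
    by rewrite pS; have [] := pqP i.
  rewrite -{1}(ordS3 i) pS' -{2}(ordS3 i) -EB.
  by have [] := pqP (ordS (ordS i)).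
- case: (ord3_cases (tag u) (tag v)) => uv.
  + by rewrite uv eqxx; apply/negP => /(adj_tag (saturated_sub satG)); rewrite uv eqxx.
  + exact: GE.
  + rewrite adj_sym GE ?uv ?ordS3 // eq_sym orbC; congr [&& _, _ & ~~ _].
    exact: andbC.
Qed.
End ExactDegree.

(** * Isomorphism of hub configurations *)

Lemma bijection_of_fibers (T : finType) (C : eqType) (f f' : T -> C) :
  (forall c, #|[pred x | f x == c]| = #|[pred x | f' x == c]|) ->
  exists h, bijective h /\ forall x, f' (h x) = f x.
Proof.
move=> eqc.
pose s x := enum [pred y | f y == f x]; pose s' x := enum [pred y | f' y == f x].
have szs x : size (s x) = size (s' x) by rewrite -!cardE eqc.
have xs x : x \in s x by rewrite mem_enum inE.
pose h x := nth x (s' x) (index x (s x)).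
have idx x : index x (s x) < size (s' x) by rewrite -szs index_mem.
have fh x : f' (h x) = f x.
  by apply/eqP; have := mem_nth x (idx x); rewrite mem_enum inE.
exists h; split=> //; apply: injF_bij => x y hxy.
have fxy : f x = f y by rewrite -!fh hxy.
have [es es'] : s x = s y /\ s' x = s' y by rewrite /s /s' fxy.
move: hxy; rewrite /h (set_nth_default y) // es es'.
have ix : index x (s y) < size (s' y) by rewrite -es -es'.
move/eqP; rewrite nth_uniq ?enum_uniq // => /eqP E.
by rewrite -(nth_index y (xs x)) -[RHS](nth_index y (xs y)) es E.
Qed.

Section HubIso.
Variables (n : 'I_3 -> nat) (l : nat).
Notation T := (vertex n).
Notation V := (part n).
Implicit Types (x y : T) (i j k : 'I_3) (G : sgraph T) (S : {set T}).

(** The third component tells which missing edges end in [x]; the guard discards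
    the meaningless values [p i i]. *)
Definition hub_color (S : {set T}) (p : 'I_3 -> 'I_3 -> T) x :
    'I_3 * bool * {ffun 'I_3 -> bool} :=
  (tag x, x \in S, [ffun j => (j != tag x) && (x == p (tag x) j)]).

Lemma hub_config_color G S p x y : hub_config l G S p ->
  let c := hub_color S p in
  G x y = [&& (c x).1.1 != (c y).1.1, (c x).1.2 || (c y).1.2
            & ~~ ((c x).2 (c y).1.1 && (c y).2 (c x).1.1)].
Proof.
case=> _ _ GE /=; rewrite GE !ffunE [tag y == _]eq_sym.
by case: (tag x == tag y).
Qed.

(** Only an endpoint of a missing edge has a colour with [g j] true, and it is
    determined by [i] and [j].  The number of vertices of the one remaining colour
    with given [i] and [b] then follows by subtraction. *)
Lemma card_hub_color_end G S p i b (g : {ffun 'I_3 -> bool}) j :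
  hub_config l G S p -> j != i -> g j ->
  #|[pred x | hub_color S p x == (i, b, g)]| =
  (b && (g == [ffun k => (k != i) && (p i j == p i k)])).
Proof.
move=> [_ pS _] ji gj.
have [pSi pt] : p i j \in S /\ tag (p i j) = i.
  have ij : i != j by rewrite eq_sym.
  by have /setIP[? ] := pS i j ij; rewrite mem_part => /eqP.
have only x : hub_color S p x == (i, b, g) -> x = p i j.
  case/eqP=> xi _ gE; move: gj; rewrite -gE ffunE xi => /andP[_ /eqP]; exact.
have colp : hub_color S p (p i j) = (i, true, [ffun k => (k != i) && (p i j == p i k)]).
  by rewrite /hub_color pSi pt.
case: (boolP (_ && _)) => [/andP[bT /eqP gE]|no].
  apply: (etrans _ (card1 (p i j))); apply: eq_card => x; rewrite !inE.
  by apply/idP/eqP => [/only //|->]; rewrite colp bT gE.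
apply: eq_card0 => x; rewrite !inE; apply: contraNF no => cx.
by move: cx (only x cx) => /[swap] ->; rewrite colp => /eqP[<- <-]; rewrite eqxx.
Qed.

Lemma card_hub_color_self S p i b (g : {ffun 'I_3 -> bool}) : g i ->
  #|[pred x | hub_color S p x == (i, b, g)]| = 0.
Proof.
move=> gi; apply: eq_card0 => x; rewrite !inE; apply/negP => /eqP[xi _ gE].
by move: gi; rewrite -gE ffunE xi eqxx.
Qed.

Lemma card_hub_color_sum S p i b :
  \sum_g #|[pred x | hub_color S p x == (i, b, g)]|
  = #|[pred x | (tag x == i) && ((x \in S) == b)]|.
Proof.
rewrite -[RHS]sum1_card (partition_big (fun x => (hub_color S p x).2) xpredT) //=.
apply: eq_bigr => g _; rewrite -sum1_card; apply: eq_bigl => x.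
by rewrite !inE /hub_color !xpair_eqE.
Qed.

Lemma card_hub_part G S p i b : hub_config l G S p ->
  #|[pred x | (tag x == i) && ((x \in S) == b)]| = if b then l else n i - l.
Proof.
move=> [cS _ _]; case: b.
  by rewrite -(cS i); apply: eq_card => x; rewrite !inE andbC eqb_id.
rewrite -(cS i) -(card_part n i) setIC -cardsD; apply: eq_card => x.
by rewrite !inE eqbF_neg andbC.
Qed.

(** Up to isomorphism a hub configuration is given by the coincidences among the
    endpoints of its missing edges: these determine how many vertices there are
    of each colour, and the colours of two vertices determine whether they are
    adjacent. *)
Lemma hub_config_isomorphic G G' S S' p p' :
  hub_config l G S p -> @hub_config n l G' S' p' ->
  (forall i j k, j != i -> k != i -> (p i j == p i k) = (p' i j == p' i k)) ->
  isomorphic G G'.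
Proof.
move=> hub hub' pp'.
have [|h [h_bij hE]] := @bijection_of_fibers _ _ (hub_color S p) (hub_color S' p').
  move=> [[i b] g].
  have ends (f : {ffun 'I_3 -> bool}) : (exists j, f j) ->
      #|[pred x | hub_color S p x == (i, b, f)]|
      = #|[pred x | hub_color S' p' x == (i, b, f)]|.
    case=> j fj; have [ji|ji] := eqVneq j i.
      by rewrite !card_hub_color_self // -ji.
    rewrite (card_hub_color_end b hub ji fj) (card_hub_color_end b hub' ji fj).
    congr (nat_of_bool (_ && (_ == _))); apply/ffunP => k; rewrite !ffunE.
    by case: (eqVneq k i) => //= ki; apply: pp'.
  case: (boolP [exists j, g j]) => [/existsP|noj]; first exact: ends.
  have gE f : f != g -> exists j, f j.
    move=> fg; apply/existsP; apply: contraR fg => nof; apply/eqP/ffunP => j.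
    by apply/idP/idP => [fj|gj]; [case/existsP: nof | case/existsP: noj]; exists j.
  have := card_hub_color_sum S' p' i b; rewrite (card_hub_part i b hub').
  rewrite -(card_hub_part i b hub) -(card_hub_color_sum S p i b).
  rewrite (bigD1 g) //= [in RHS](bigD1 g) //=.
  rewrite (eq_bigr (fun f => #|[pred x | hub_color S p x == (i, b, f)]|)) => [/addIn //|f].
  by move/gE/ends.
exists h; split=> // x y.
by rewrite (hub_config_color _ _ hub) (hub_config_color _ _ hub') !hE.
Qed.

End HubIso.

(** * The extremal graphs *)

Section Extremal.
Variables (n : 'I_3 -> nat) (l : nat).
Hypothesis l_gt0 : 0 < l.
Hypothesis n_big : forall i, l + l < n i.
Notation T := (vertex n).
Notation V := (part n).

Let n_gt0 i : 0 < n i. Proof. exact: leq_ltn_trans (n_big i). Qed.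

Let n_pred i b : n i - b.+1 < n i.
Proof. by have := n_gt0 i; lia. Qed.

(** The missing edges of [G1] and [G2] end in the last or the last but one vertex
    of a part. *)
Definition near_last (i : 'I_3) (b : bool) : T :=
  existT _ i (Ordinal (n_pred i b)).

Lemma label_near_last i (b : bool) : label (near_last i b) = (i, n i - b).
Proof. by rewrite /label /=; congr (_, _); case: b; have := n_big i; lia. Qed.

Lemma label_inj : injective (@label n).
Proof.
move=> [i a] [j b]; rewrite /label /= => -[ij]; subst j => ab.
by congr existT; apply: val_inj; case: ab.
Qed.

Lemma near_last_eq x i (b : bool) : (x == near_last i b) = (label x == (i, n i - b)).
Proof. by rewrite -label_near_last (inj_eq label_inj). Qed.

Definition hubs : {set T} := [set x | in_S l x].

Lemma card_hubs i : #|hubs :&: V i| = l.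
Proof.
have inj : injective (fun a : 'I_(n i) => (existT _ i a : T)).
  by move=> a b /eqP; rewrite eq_Tagged /= => /eqP.
have -> : hubs :&: V i =
    [set (existT _ i a : T) | a : 'I_(n i) & n i - l <= a].
  apply/setP => x; rewrite !inE /in_S /label /= addn1 ltnS.
  apply/andP/imsetP => [[xS /eqP xi]|[a]]; last by rewrite inE => ? ->.
  by clear inj; subst i; exists (tagged x); [rewrite inE | case: x {xS}].
rewrite card_imset // -sum1_card.
rewrite (eq_bigl (fun a : 'I_(n i) => n i - l <= a)) => [|a]; last by rewrite inE.
rewrite -(big_mkord (fun a => n i - l <= a) (fun=> 1)).
rewrite (big_cat_nat (n := n i - l)) ?leq_subr //=.
rewrite big_nat_cond big_pred0 => [|a]; last by rewrite andbC; lia.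
rewrite big_nat_cond (eq_bigl (fun a => n i - l <= a < n i)) => [|a]; last by lia.
rewrite -big_nat sum_nat_const_nat; have := n_big i; lia.
Qed.

Lemma near_last_hub i (b : bool) : b < l -> near_last i b \in hubs :&: V i.
Proof.
by move=> bl; rewrite !inE /in_S label_near_last /= eqxx; have := n_big i; lia.
Qed.

Lemma hub_graph_config D p :
  (forall i j, i != j -> p i j \in hubs :&: V i) ->
  (forall i j a b, i != j -> (((i, a), (j, b)) \notin D)
      && (((j, b), (i, a)) \notin D)
    = ~~ (((i, a) == label (p i j)) && ((j, b) == label (p j i)))) ->
  hub_config l (hub_graph n l D) hubs p.
Proof.
move=> pS DE; split=> [i|//|x y]; first exact: card_hubs.
rewrite /= /hub_rel !inE; case: (boolP (tag x == tag y)) => //= xy; congr (_ && _).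
by rewrite -(inj_eq label_inj) -(inj_eq label_inj y) -DE.
Qed.

Lemma G1_hub_config : hub_config l (G1 n l) hubs (fun i _ => near_last i false).
Proof.
apply: hub_graph_config => [i j _|i j a b]; first exact: near_last_hub.
rewrite !label_near_last !subn0 !inE !xpair_eqE !eqxx /=.
by case: (ord3_cases ord0 i) => ->; case: (ord3_cases ord0 j) => -> //= _;
  do 4?case: eqP => _.
Qed.

Lemma G2_hub_config i : 1 < l ->
  hub_config l (G2 n l i) hubs
    (fun s t => near_last s ((s == i) && (t == ordS (ordS i)))).
Proof.
move=> l1; apply: hub_graph_config => [s t _|s t a b].
  by apply: near_last_hub; apply: leq_ltn_trans l1; case: (_ && _).
rewrite !label_near_last !inE !xpair_eqE !eqxx /=.
have h1 := negbTE (ordS_neq i); have h2 := negbTE (ordS_ordS_neq i).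
have h3 := negbTE (ordS_neq (ordS i)).
have [h1' h2' h3'] : [/\ (i == ordS i) = false, (i == ordS (ordS i)) = false
   & (ordS i == ordS (ordS i)) = false] by split; rewrite eq_sym.
by case: (ord3_cases i s) => ->; case: (ord3_cases i t) => ->;
  rewrite ?eqxx ?h1 ?h2 ?h3 ?h1' ?h2' ?h3' //= ?subn0 ?orbF ?andbF ?andbT //= => _;
  do 4?case: eqP => _.
Qed.

Lemma G1_saturated : saturated_subgraph (complete_tripartite n)
  (complete_tripartite (fun _ => l)) (G1 n l).
Proof.
apply: (hub_config_saturated l_gt0 _ G1_hub_config) => [i|i j k _ _ _]; last by left.
exact: ltnW.
Qed.

Lemma G2_saturated i : 1 < l -> saturated_subgraph (complete_tripartite n)
  (complete_tripartite (fun _ => l)) (G2 n l i).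
Proof.
move=> l1; apply: (hub_config_saturated l_gt0 _ (G2_hub_config i l1)).
  by move=> j; apply: ltnW.
move=> s t u st su tu.
case: (s =P i) => [si|_]; last by left.
by right; case: (t =P i) => // ti; rewrite ti si eqxx in st.
Qed.

(** If the two missing edges at part [i] have different endpoints there, each of
    them shares its other endpoint with the missing edge between the two other
    parts. *)
Lemma hub_config_classification (G : sgraph T) S (p : 'I_3 -> 'I_3 -> T) :
  hub_config l G S p -> linked p ->
  isomorphic G (G1 n l) \/ exists i, isomorphic G (G2 n l i).
Proof.
move=> hub link; have [cS pS _] := hub.
have nS (i : 'I_3) : i != ordS i by rewrite eq_sym ordS_neq.
have nSS (i : 'I_3) : i != ordS (ordS i) by rewrite eq_sym ordS_ordS_neq.
have same (q q' : 'I_3 -> 'I_3 -> T) :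
    (forall i, (q i (ordS i) == q i (ordS (ordS i)))
             = (q' i (ordS i) == q' i (ordS (ordS i)))) ->
    forall i j k, j != i -> k != i -> (q i j == q i k) = (q' i j == q' i k).
  move=> qq i j k; case: (ord3_cases i j) => ->; case: (ord3_cases i k) => ->;
    by rewrite ?eqxx //= ![_ (ordS (ordS i)) == _]eq_sym.
case: (boolP [forall i, p i (ordS i) == p i (ordS (ordS i))]) => [/forallP all_eq|].
  left; apply: (hub_config_isomorphic hub G1_hub_config); apply: same => i.
  by rewrite all_eq eqxx.
rewrite negb_forall => /existsP[i pi]; right; exists i.
have l1 : 1 < l.
  rewrite -(cS i) (cardsD1 (p i (ordS i))) pS //= add1n ltnS.
  by apply/card_gt0P; exists (p i (ordS (ordS i))); rewrite in_setD1 pS // eq_sym pi.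
apply: (hub_config_isomorphic hub (G2_hub_config i l1)); apply: same => t.
have [->|ti] := eqVneq t i.
  rewrite (negbTE pi) eqxx /= (negbTE (nS (ordS i))) near_last_eq label_near_last.
  by rewrite xpair_eqE eqxx /=; have := n_big i; lia.
rewrite eqxx; apply/eqP.
have [u tu iu] : exists2 u, t != u & i != u by apply: ord3_third.
have it : i != t by rewrite eq_sym.
have [E|E] := link i t u it iu tu.
  by case/negP: pi; case: (ord3_distinct it iu tu) E => -[-> ->] ->.
by case: (ord3_distinct ti tu iu) E => -[-> ->] ->.
Qed.
End Extremal.

(** * The saturation number *)

Lemma saturated_edges_ge (n : 'I_3 -> nat) (l : nat) (G : sgraph (vertex n))
    (a := ord0 : 'I_3) (b := ordS a) (c := ordS b) :
  0 < l -> (forall i, 72 * l * l + 11 * l <= n i) -> n b <= n a -> n c <= n b ->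
  saturated_subgraph (complete_tripartite n) (complete_tripartite (fun _ => l)) G ->
  2 * l * \sum_i n i <= #|edges G| + 3 * l ^ 2 + 3 /\
  (#|edges G| + 3 * l ^ 2 + 3 = 2 * l * \sum_i n i ->
    exists S p, hub_config l G S p).
Proof.
move=> l_gt0 n_big ba cb satG.
have n_gt i : l + l < n i by have := n_big i; nia.
case: (ltnP #|edges G| (2 * l * \sum_i n i)) => [few|many]; last by lia.
have [x xP] := @exact_degree_all n l l_gt0 G satG n_big few a b c isT isT isT ba cb.
exact: (exact_degree_hub l_gt0 satG n_gt xP).
Qed.

Theorem theorem5 (l n1 n2 n3 : nat) (hl : 0 < l)
    (hn1 : 0 < n1) (hn2 : 0 < n2) (hn3 : 0 < n3)
    (h12 : n2 <= n1) (h23 : n3 <= n2)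
    (hlarge : 32 * l ^ 3 + 40 * l ^ 2 + 11 * l <= n3) :
  let n := sizes n1 n2 n3 in
  let H := complete_tripartite n in
  let F := complete_tripartite (fun _ => l) in
  let m := 2 * l * (n1 + n2 + n3) - 3 * l ^ 2 - 3 in
  [/\ is_sat H F m,
      saturated_subgraph H F (G1 n l) /\ #|edges (G1 n l)| = m,
      (forall i : 'I_3, 1 < l ->
         saturated_subgraph H F (G2 n l i) /\ #|edges (G2 n l i)| = m) &
      forall G : sgraph (vertex n),
        saturated_subgraph H F G -> #|edges G| = m ->
        isomorphic G (G1 n l) \/ exists i : 'I_3, isomorphic G (G2 n l i)].
Proof.
move=> n H F m.
have n3_big : 72 * l * l + 11 * l <= n3.
  apply: leq_trans hlarge; rewrite leq_add2r !expnS expn0 muln1.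
  have : l * l <= l * (l * l) by rewrite leq_mul2l leq_pmulr ?orbT.
  by lia.
have n_big i : 72 * l * l + 11 * l <= n i.
  apply: leq_trans n3_big _.
  by case: i => [[|[|[|i]]] hi] //; rewrite /n /sizes /=; lia.
have n_gt i : l + l < n i by have := n_big i; nia.
have sum_n : \sum_i n i = n1 + n2 + n3 by rewrite !big_ord_recl big_ord0 addn0 addnA.
have mE : m + 3 * l ^ 2 + 3 = 2 * l * \sum_i n i.
  have h1 : l * (11 * l) <= l * n3.
    by rewrite leq_mul2l (leq_trans (leq_addl _ _) n3_big) orbT.
  have h2 : 0 < l * l by rewrite muln_gt0 hl.
  have h3 : 3 * l ^ 2 + 3 <= 2 * l * (n1 + n2 + n3).
    by rewrite -mulnn -mulnA !mulnDr; lia.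
  by rewrite sum_n /m -subnDA -addnA subnK.
have hub_edges (G : sgraph (vertex n)) S p : hub_config l G S p -> #|edges G| = m.
  by move/hub_config_edges; rewrite -mE => /addIn/addIn.
have bound (G : sgraph (vertex n)) : saturated_subgraph H F G ->
    m <= #|edges G| /\ (#|edges G| = m -> exists S p, hub_config l G S p).
  move=> satG; have [lb eq_hub] := saturated_edges_ge hl n_big h12 h23 satG.
  split=> [|E]; first by rewrite -mE -!addnA leq_add2r in lb.
  by apply: eq_hub; rewrite E mE.
have sat1 : saturated_subgraph H F (G1 n l) by apply: G1_saturated.
have edges1 : #|edges (G1 n l)| = m.
  exact: hub_edges _ _ _ (G1_hub_config hl n_gt).
split.
- by split=> [|G /bound[]//]; exists (G1 n l).
- by [].
- move=> i l1; split; first exact: G2_saturated.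
  exact: hub_edges _ _ _ (G2_hub_config hl n_gt i l1).
- move=> G satG /(proj2 (bound G satG))[S [p hub]].
  apply: (hub_config_classification hl n_gt hub).
  by apply: (saturated_linked hl _ hub satG) => i; apply: ltnW.
Qed.
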